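(* Let $j\in\mathbb{Z}_{\ge 0}$ and $k\in\mathbb{Z}_{>0}$. Then $$\sum_{n=1}^{\infty}\frac{\binom{2n}{n}}{n^k4^n}\,\zeta_n^{\star}(\{2\}_j)=-\frac{2^k}{(k-1)!}\int_0^1\frac{\ln^{k-1}\!\left(\frac{1+t}{2\sqrt{t}}\right)\operatorname{Li}_{2j}(-t)}{t}\,dt.$$
   Context: For $n\in\mathbb{Z}_{>0}$ and $j\in\mathbb{Z}_{\ge 0}$, the multiple harmonic star sum is $$\zeta_n^{\star}(\{2\}_j):=\sum_{n\ge n_1\ge\cdots\ge n_j\ge 1}\prod_{i=1}^j\frac{1}{n_i^2},$$ where the $n_i$ are integers, with the convention $\zeta_n^{\star}(\{2\}_0)=\zeta_n^\star(\emptyset)=1$. The polylogarithm is $\operatorname{Li}_s(x):=\sum_{n=1}^{\infty}\frac{x^n}{n^s}$ for $|x|<1$, $s\in\mathbb{C}$ (also for $x=1$ if $\Re(s)>1$ and for $x=-1$ if $\Re(s)>0$). $\ln^{k-1}(\cdot)$ denotes the $(k-1)$-th power of the natural logarithm. *)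

(* Defs.v *)
From HB Require Import structures.
From mathcomp Require Import all_boot all_order all_algebra.
From mathcomp Require Import all_classical all_reals all_analysis.
Import Order.TTheory GRing.Theory Num.Theory.
Import numFieldNormedType.Exports.

Set Implicit Arguments.
Unset Strict Implicit.
Unset Printing Implicit Defensive.

Local Open Scope ring_scope.

(* The entries of [s] range over {0, ..., n}; position 0 of [s] is the largest
   index n_1, and the condition on [sorted] and [all] reads
   n >= n_1 >= ... >= n_j >= 1. *)
Definition zeta_star2 (R : realType) (n j : nat) : R :=
  \sum_(s : j.-tuple 'I_n.+1 |
      sorted geq (map val s) && all (fun i : 'I_n.+1 => (0 < i)%N) s)
    \prod_(i < j) ((tnth s i)%:R ^+ 2)^-1.

(* Li_s(x) for natural s. As [limn] is total, the value is meaningful only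
   where the series converges, e.g. for every s when `|x| < 1. *)
Definition polylog (R : realType) (s : nat) (x : R) : R :=
  limn (fun N => \sum_(1 <= n < N) (x ^+ n / n%:R ^+ s)).

(* Main.v *)
(* With x = 4 t / (1 + t) ^ 2 one has ln ((1 + t) / (2 sqrt t)) = - ln x / 2, so
   that the substitution t |-> x turns the right-hand side into moments of powers
   of ln x, for which the integral of x ^ (n - 1) ln ^ (k - 1) (1 / x) over [0, 1]
   is (k - 1)! / n ^ k. It therefore suffices to show, for 0 < t < 1,
     sum_n 'C(2n, n) 4 ^ - n zeta_n^* x ^ n = - 2 (1 + t) / (1 - t) Li_{2j} (- t);
   all summands on the left are nonnegative, so sum and integral may be exchanged.
   This follows from
     'C(2n, n) zeta_n^*({2}_j) = 2 sum_{m = 1}^n (-1) ^ (m - 1) 'C(2n, n + m) / m ^ 2j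
   and sum_n 'C(2n, n + m) (x / 4) ^ n = t ^ m (1 + t) / (1 - t). *)
Require Import Defs.
From HB Require Import structures.
From mathcomp Require Import all_boot all_order all_algebra.
From mathcomp Require Import all_classical all_reals all_analysis.
From mathcomp Require Import measurable_realfun.
From mathcomp Require Import ring lra zify.
Import Order.TTheory GRing.Theory Num.Theory.
Import numFieldNormedType.Exports.
Local Open Scope classical_set_scope.
Local Open Scope ring_scope.

(** * The star sum as an alternating binomial sum *)

Section ZetaStar.
Variable R : realType.
Implicit Types (n m j : nat).

(** Nested sums with the largest index outermost, a form open to induction on both [j] and [n]. *)
Fixpoint zeta_rec (j n : nat) : R :=
  if j is j'.+1 then \sum_(1 <= i < n.+1) zeta_rec j' i / i%:R ^+ 2 else 1.

Lemma zeta_recS j n :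
  zeta_rec j.+1 n.+1 = zeta_rec j.+1 n + zeta_rec j n.+1 / n.+1%:R ^+ 2.
Proof. by rewrite /= big_nat_recr. Qed.

Lemma zeta_rec_ge0 j n : 0 <= zeta_rec j n.
Proof.
elim: j n => [|j IH] n //=; apply: sumr_ge0 => i _.
by rewrite divr_ge0 ?exprn_ge0.
Qed.

(* The bound [M] of the index type is decoupled from the bound [n] of the indices,
   since [M] stays fixed along the recursion on [j]. *)
Lemma sum_path_geqE j M n : (n <= M)%N ->
  \sum_(s : j.-tuple 'I_M.+1 |
      path geq n (map val s) && all (fun i : 'I_M.+1 => (0 < i)%N) s)
    \prod_(i < j) ((tnth s i)%:R ^+ 2)^-1 = zeta_rec j n.
Proof.
elim: j n => [|j IH] n nM.
  rewrite (big_pred1 [tuple]) ?big_ord0// => s.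
  by rewrite tuple0; apply/esym/eqP; apply: val_inj; case: s => -[].
(* Split a tuple into its head, the largest index, and its tail. *)
rewrite (reindex (fun p : 'I_M.+1 * j.-tuple 'I_M.+1 => cons_tuple p.1 p.2)) /=;
  last first.
  exists (fun s : j.+1.-tuple 'I_M.+1 => (thead s, [tuple of behead s])).
    by move=> [i s] _ /=; congr (_, _); apply: val_inj.
  by move=> s _; rewrite [RHS](tuple_eta s); apply: val_inj.
under eq_bigr do rewrite big_ord_recl /= tnth0.
under eq_bigr do under eq_bigr do rewrite tnthS.
transitivity (\sum_(i < M.+1 | (0 < i <= n)%N) ((i%:R : R) ^+ 2)^-1 *
   \sum_(s : j.-tuple 'I_M.+1 |
      path geq i (map val s) && all (fun i : 'I_M.+1 => (0 < i)%N) s)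
    \prod_(k < j) ((tnth s k)%:R ^+ 2)^-1).
  under [RHS]eq_bigr do rewrite big_distrr.
  rewrite pair_big_dep /=; apply: eq_bigl => -[i s] /=.
  by case: (0 < i)%N; case: (leq i n); rewrite ?andbF ?andbT.
transitivity (\sum_(i < M.+1 | (0 < i <= n)%N) zeta_rec j i / i%:R ^+ 2).
  by apply: eq_bigr => i /andP[_ iln]; rewrite IH ?(leq_trans iln)// mulrC.
rewrite -(big_mkord (fun i => (0 < i <= n)%N)
  (fun i => zeta_rec j i / i%:R ^+ 2)).
rewrite (big_cat_nat _ (n := n.+1))//= [X in _ + X]big_nat_cond.
rewrite [X in _ + X]big_pred0 ?addr0; last first.
  by move=> i; apply/negbTE; lia.
rewrite big_ltn_cond//= big_nat_cond [RHS]big_nat_cond.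
by apply: eq_bigl => i; lia.
Qed.

Lemma zeta_star2E n j : zeta_star2 R n j = zeta_rec j n.
Proof.
rewrite -(sum_path_geqE j n n)//; apply: eq_bigl => s; congr (_ && _).
(* Starting the path at [n] only adds that the head is at most [n], which its type ['I_n.+1]
   guarantees. *)
case: s => -[|i s] //= _.
by rewrite -ltnS ltn_ord.
Qed.

Lemma zeta_star2_ge0 n j : 0 <= zeta_star2 R n j.
Proof. by rewrite zeta_star2E zeta_rec_ge0. Qed.

Lemma zeta_star2S n j : zeta_star2 R n.+1 j.+1 =
  zeta_star2 R n j.+1 + zeta_star2 R n.+1 j / n.+1%:R ^+ 2.
Proof. by rewrite !zeta_star2E zeta_recS. Qed.

Lemma zeta_star2_0l j : zeta_star2 R 0 j.+1 = 0.
Proof. by rewrite zeta_star2E /= big_geq. Qed.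

Lemma zeta_star2_0r n : zeta_star2 R n 0 = 1.
Proof. by rewrite zeta_star2E. Qed.

Lemma sum_inv_square_le n : \sum_(1 <= i < n.+2) (i%:R ^+ 2)^-1 <= 2 - n.+1%:R^-1 :> R.
Proof.
elim: n => [|n IH]; first by rewrite big_nat1 expr1n invr1; lra.
rewrite big_nat_recr//= (le_trans (lerD IH (lexx _)))//.
have : 0 < n.+1%:R :> R by rewrite ltr0n.
rewrite -[n.+2%:R]natr1; move: n.+1%:R => x x0.
(* With x = n + 1, the slack is 1/x - 1/(x + 1) - 1/(x + 1)^2. *)
rewrite -subr_ge0 [leRHS](_ : _ = (x * (x + 1) ^+ 2)^-1).
  by rewrite invr_ge0 mulr_ge0 ?exprn_ge0 ?addr_ge0// ltW.
by field; rewrite !lt0r_neq0// ltr_wpDr.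
Qed.

(** Each of the [j] nested sums contributes a factor of at most 2. Being uniform in [n], the bound
    serves to dominate the final series. *)
Lemma zeta_star2_le n j : zeta_star2 R n j <= 2 ^+ j.
Proof.
rewrite zeta_star2E; elim: j n => [|j IH] n /=; first by rewrite expr0.
rewrite (@le_trans _ _ (\sum_(1 <= i < n.+1) 2 ^+ j * (i%:R ^+ 2)^-1))//.
  by apply: ler_sum => i _; rewrite ler_wpM2r ?invr_ge0 ?exprn_ge0.
rewrite -big_distrr/= exprSr ler_wpM2l ?exprn_ge0//.
case: n => [|n]; first by rewrite big_geq.
by rewrite (le_trans (sum_inv_square_le n))// gerDl oppr_le0 invr_ge0.
Qed.

End ZetaStar.

(** * Centred binomial coefficients *)

Section CentralBinomial.
Variable R : realType.
Implicit Types (n m j : nat).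

(** Pascal's rule, applied twice. *)
Lemma bin_halfS n m :
  'C(2 * n.+1, n.+1 + m.+1) =
  ('C(2 * n, n + m) + 2 * 'C(2 * n, n + m.+1) + 'C(2 * n, n + m.+2))%N.
Proof.
have -> : (2 * n.+1 = (2 * n).+2)%N by lia.
have -> : (n.+1 + m.+1 = (n + m).+2)%N by lia.
by move: (2 * n)%N => p; rewrite !addnS !binS; lia.
Qed.

(** The same at the centre, where symmetry identifies the two neighbours of the central
    coefficient. *)
Lemma bin_halfS0 n :
  'C(2 * n.+1, n.+1) = (2 * 'C(2 * n, n) + 2 * 'C(2 * n, n.+1))%N.
Proof.
have -> : (2 * n.+1 = (2 * n).+2)%N by lia.
case: n => [|n] //; have : (2 * n.+1 = n.+1 + n.+1)%N by lia.
move: (2 * n.+1)%N => p pE; rewrite !binS.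
have -> : 'C(p, n) = 'C(p, n.+2) by rewrite -bin_sub; [congr 'C(_, _)|]; lia.
lia.
Qed.

(** Comparison of factorials. Truncated subtraction is harmless, since both binomials vanish for m >
    n + 1. *)
Lemma mul_bin_halfS n m :
  ('C(2 * n.+1, n.+1 + m) * ((n.+1 + m) * (n.+1 - m)) =
   2 * n.+1 * (2 * n).+1 * 'C(2 * n, n + m))%N.
Proof.
have e : (2 * n.+1 = (2 * n).+2)%N by lia.
have [mn|nm] := leqP m n.+1; last by rewrite !bin_small; lia.
have := mul_bin_diag (2 * n.+1) (n + m).
have := mul_bin_down (2 * n).+1 (n + m).
rewrite e /= addSn; have -> : ((2 * n).+1 - (n + m) = n.+1 - m)%N by lia.
move=> h1 h2.
rewrite [LHS]mulnA [('C(_, _) * _)%N]mulnC -h2 -mulnA [('C(_, _) * _)%N]mulnC -h1.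
by rewrite mulnA.
Qed.

Lemma bin_half_gt0 n : 0 < 'C(2 * n, n)%:R :> R.
Proof. by rewrite ltr0n bin_gt0; lia. Qed.

(* As [(n+1) ^ 2 / m ^ 2] times the increment in [n] of this ratio is the ratio at
   [n+1], raising [j] by one amounts to dividing the [m]-th term by [m ^ 2]. *)
Lemma bin_half_ratioS n m :
  'C(2 * n.+1, n.+1 + m)%:R / 'C(2 * n.+1, n.+1)%:R * (n.+1%:R ^+ 2 - m%:R ^+ 2) =
  'C(2 * n, n + m)%:R / 'C(2 * n, n)%:R * n.+1%:R ^+ 2 :> R.
Proof.
have [mn|nm] := leqP m n.+1; last first.
  by rewrite [X in X%:R / _ * _ = _]bin_small ?[X in _ = X%:R / _ * _]bin_small ?mul0r//; lia.
(* The claim is the quotient of [mul_bin_halfS] at [m] by its instance at 0. *)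
have h0 := congr1 (fun k => k%:R : R) (mul_bin_halfS n 0).
have h1 := congr1 (fun k => k%:R : R) (mul_bin_halfS n m).
rewrite !natrM subn0 !addn0 in h0; rewrite !natrM natrD natrB// in h1.
have b1 := lt0r_neq0 (bin_half_gt0 n.+1).
have b0 := lt0r_neq0 (bin_half_gt0 n).
have c0 : 2 * n.+1%:R * (2 * n).+1%:R != 0 :> R by rewrite !mulf_neq0 ?pnatr_eq0.
apply: (mulIf b1); apply: (mulIf b0); apply: (mulIf c0).
transitivity ('C(2 * n.+1, n.+1 + m)%:R * ((n.+1%:R + m%:R) * (n.+1%:R - m%:R)) *
   (2%:R * n.+1%:R * (2 * n).+1%:R * 'C(2 * n, n)%:R) : R).
  by field.
by rewrite h1 -h0; field.
Qed.

(** The base case j = 0 of the binomial formula. By Pascal's rule each term is an increment in [m]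
    of (-1)^m 'C(2n - 1, n + m), so the sum telescopes. *)
Lemma altsum_bin_half n N : (0 < n < N)%N ->
  2 * \sum_(1 <= m < N) (-1) ^+ m * 'C(2 * n, n + m)%:R = - 'C(2 * n, n)%:R :> R.
Proof.
case: n => // n /= nN.
have e : (2 * n.+1 = (2 * n).+2)%N by lia.
have tel M : \sum_(1 <= m < M.+1) (-1) ^+ m * 'C(2 * n.+1, n.+1 + m)%:R =
    (-1) ^+ M * 'C((2 * n).+1, n.+1 + M)%:R - 'C((2 * n).+1, n.+1)%:R :> R.
  elim: M => [|M IH]; first by rewrite big_geq// addn0 expr0 mul1r subrr.
  rewrite big_nat_recr//= IH e addnS (binS (2 * n).+1) natrD exprS; ring.
case: N nN => // N nN; rewrite tel (@bin_small (2 * n).+1 (n.+1 + N)); last by lia.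
have -> : 'C(2 * n.+1, n.+1) = (2 * 'C((2 * n).+1, n.+1))%N.
  rewrite e (binS (2 * n).+1) (_ : 'C((2 * n).+1, n) = 'C((2 * n).+1, n.+1)); first lia.
  by rewrite -bin_sub; [congr 'C(_, _)|]; lia.
rewrite natrM; ring.
Qed.

(** Induction on [j], then on [n]: after division by 'C(2n, n), both sides have the same increment
    in [n]. Terms with m > n vanish, so any cut-off [N] above [n] will do; a common one later allows
    the sums to be exchanged. At n = j = 0 the left side is 1 and the right side 0. *)
Lemma bin_half_zeta_star2 n j N : (0 < n + j)%N -> (n < N)%N ->
  'C(2 * n, n)%:R * zeta_star2 R n j =
  - 2 * \sum_(1 <= m < N) (-1) ^+ m * 'C(2 * n, n + m)%:R / m%:R ^+ (2 * j).
Proof.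
move=> nj nN; have b n' := lt0r_neq0 (bin_half_gt0 n').
suff -> : zeta_star2 R n j = - 2 * \sum_(1 <= m < N)
    (-1) ^+ m * ('C(2 * n, n + m)%:R / 'C(2 * n, n)%:R) / m%:R ^+ (2 * j).
  rewrite mulrCA big_distrr/=; congr (_ * _); apply: eq_bigr => m _.
  rewrite !mulrA; congr (_ / _); field; exact: b.
elim: j n nj nN => [|j IHj] n nj nN.
  rewrite addn0 in nj; rewrite zeta_star2_0r.
  under eq_bigr do rewrite muln0 expr0 divr1 mulrA.
  rewrite -big_distrl/= mulrA mulNr altsum_bin_half ?nj// opprK divff//.
elim: n nN {nj} => [|n IHn] nN.
  rewrite zeta_star2_0l big_nat big1 ?mulr0// => m /andP[m0 _].
  by rewrite bin_small ?mul0r ?mulr0 ?mul0r//; lia.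
rewrite zeta_star2S IHn 1?IHj//; last by exact: ltnW.
rewrite -mulrA -mulrDr; congr (_ * _); rewrite mulr_suml -big_split/=.
apply: eq_big_nat => m /andP[m0 _].
have mR : m%:R != 0 :> R by rewrite pnatr_eq0 -lt0n.
have nR : n.+1%:R != 0 :> R by rewrite pnatr_eq0.
have -> : 'C(2 * n, n + m)%:R / 'C(2 * n, n)%:R =
  'C(2 * n.+1, n.+1 + m)%:R / 'C(2 * n.+1, n.+1)%:R *
     (n.+1%:R ^+ 2 - m%:R ^+ 2) / n.+1%:R ^+ 2 :> R.
  by rewrite bin_half_ratioS mulfK// expf_neq0.
set a := _ / 'C(2 * n.+1, n.+1)%:R.
rewrite mulnS exprD; have := expf_neq0 (2 * j) mR.
move: n.+1%:R m%:R (m%:R ^+ (2 * j)) nR mR => x y z x0 y0 z0; field.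
by rewrite x0 y0 z0.
Qed.

(* With [b n = 'C(2n, n) / 4 ^ n], [b n / n <= 2 (b n.-1 - b n)] telescopes. *)
Lemma sum_bin_half_le N :
  \sum_(1 <= n < N) 'C(2 * n, n)%:R / (n%:R * 4 ^+ n) <= 2 :> R.
Proof.
suff h M : \sum_(1 <= n < M.+1) 'C(2 * n, n)%:R / (n%:R * 4 ^+ n) <=
    2 * (1 - 'C(2 * M, M)%:R / 4 ^+ M) :> R.
  case: N => [|M]; first by rewrite big_geq.
  rewrite (le_trans (h M))// ler_piMr// gerBl divr_ge0// exprn_ge0//.
elim: M => [|M IH]; first by rewrite big_geq// bin0 expr0; lra.
rewrite big_nat_recr//= (le_trans (lerD IH (lexx _)))// -subr_ge0.
have h0 := congr1 (fun k => k%:R : R) (mul_bin_halfS M 0).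
rewrite !natrM subn0 !addn0 in h0.
have m1 : M.+1%:R != 0 :> R by rewrite pnatr_eq0.
have m2 : (2 * M).+1%:R != 0 :> R by rewrite pnatr_eq0.
have -> : 'C(2 * M, M)%:R = 'C(2 * M.+1, M.+1)%:R * M.+1%:R / (2 * (2 * M).+1%:R) :> R.
  apply: (mulfI m1); apply: (mulfI m2); apply: (@mulfI R 2); first by rewrite pnatr_eq0.
  transitivity (2%:R * M.+1%:R * (2 * M).+1%:R * 'C(2 * M, M)%:R : R); first by ring.
  by rewrite -h0; field.
set c := 'C(2 * M.+1, M.+1)%:R.
rewrite [leRHS](_ : _ = c / 4 ^+ M.+1 / (M.+1%:R * (2 * M).+1%:R)).
  by rewrite !divr_ge0 ?mulr_ge0 ?exprn_ge0 ?ler0n.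
have := expf_neq0 M (_ : 4 != 0 :> R); rewrite pnatr_eq0 => /(_ isT).
rewrite exprS -[(2 * M).+1%:R]natr1 -[M.+1%:R]natr1 natrM in m1 m2 *.
by move: M%:R (4 ^+ M) m1 m2 => x z x1 x2 z0; field; rewrite x1 x2 z0.
Qed.

End CentralBinomial.

(** * The generating function of the star sums *)

Section GeneratingFunction.
Variable R : realType.
Implicit Types (t x q : R) (n m j N : nat).

(** Divided by 1 - q, the right side is 1 + q + ... + q^(N-1), whose [N] terms are all at least
    q^N. *)
Lemma natmul_expr_le q N : 0 <= q <= 1 -> N%:R * q ^+ N * (1 - q) <= 1 - q ^+ N.
Proof.
move=> /andP[q0 q1]; elim: N => [|N IH]; first by rewrite expr0 !mul0r subrr.
have qN1 : q ^+ N <= 1 by rewrite exprn_ile1.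
have qN0 : 0 <= q ^+ N by rewrite exprn_ge0.
rewrite -natr1 exprS; move: (q ^+ N) IH qN0 qN1 => p IH p0 p1; move: N%:R IH => n IH.
have := ler_wpM2l q0 IH.
have : 0 <= (1 - q) * (1 - q * p) by rewrite mulr_ge0 ?subr_ge0 ?mulr_ile1.
nra.
Qed.

(** With q = sqrt x, N x^N = (N q^N) q^N, and the first factor is at most 1/(1 - q). *)
Lemma cvg_natmul_expr x : 0 <= x < 1 -> N%:R * x ^+ N @[N --> \oo] --> (0 : R).
Proof.
move=> /andP[x0 x1]; set q := Num.sqrt x.
have q0 : 0 <= q by exact: sqrtr_ge0.
have q1 : q < 1 by rewrite -(@sqrtr1 R) ltr_sqrt.
have xq : x = q * q by rewrite -expr2 sqr_sqrtr.
have h0 : (1 - q)^-1 * q ^+ N @[N --> \oo] --> (0 : R).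
  rewrite -[X in _ --> X](mulr0 (1 - q)^-1); apply: cvgMr.
  by apply: cvg_expr; rewrite ger0_norm.
apply: (squeeze_cvgr _ (cvg_cst 0) h0); apply: nearW => N.
rewrite mulr_ge0 ?exprn_ge0//= xq exprMn mulrA ler_wpM2r ?exprn_ge0//.
rewrite -[leRHS]mul1r ler_pdivlMr ?subr_gt0//.
have q01 : 0 <= q <= 1 by rewrite q0 ltW.
by rewrite (le_trans (natmul_expr_le _ N q01))// gerBl exprn_ge0.
Qed.

Lemma is_cvg_polylog s x : `|x| < 1 ->
  cvgn (fun N => \sum_(1 <= n < N) x ^+ n / n%:R ^+ s).
Proof.
move=> x1.
suff c : cvgn (series (fun n => x ^+ n.+1 / n.+1%:R ^+ s)).
  apply/cvg_ex; exists (limn (series (fun n => x ^+ n.+1 / n.+1%:R ^+ s))).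
  by rewrite -cvg_shiftS /=; under eq_cvg do rewrite big_add1.
apply: normed_cvg; apply: (@series_le_cvg _ _ (geometric 1 `|x|)) => [n|n|n|].
- exact: normr_ge0.
- by rewrite /= mul1r exprn_ge0.
- rewrite /= mul1r normrM normfV normrX [`|_%:R ^+ _|]ger0_norm ?exprn_ge0//.
  rewrite ler_pdivrMr ?exprn_gt0// exprSr ler_wpM2l ?exprn_ge0//.
  by rewrite (le_trans (ltW x1))// -natrX ler1n expn_gt0.
- by apply: is_cvg_geometric_series; rewrite normr_id.
Qed.

(* The sequences [m |-> t ^ m] and [m |-> 'C(2n, n + m)] obey the same three-term
   recursion, whose norm on bounded sequences is [4 t / (1 + t) ^ 2]. *)
Lemma bin_half_tail t N m : 0 <= t < 1 ->
  0 <= t ^+ m * ((1 + t) / (1 - t)) -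
       \sum_(0 <= n < N) 'C(2 * n, n + m)%:R * (t / (1 + t) ^+ 2) ^+ n
    <= (4 * (t / (1 + t) ^+ 2)) ^+ N * ((1 + t) / (1 - t)).
Proof.
move=> /andP[t0 t1].
have e0 : 0 <= (1 + t) / (1 - t) by apply: divr_ge0; lra.
have y0 : 0 <= t / (1 + t) ^+ 2 by rewrite divr_ge0 ?exprn_ge0 ?addr_ge0.
have t1n : 1 + t != 0 by rewrite lt0r_neq0// ltr_wpDr.
have t1n' : 1 - t != 0 by rewrite subr_eq0 gt_eqF.
elim: N m => [|N IH] m.
  rewrite big_geq// subr0 expr0 mul1r mulr_ge0 ?exprn_ge0//=.
  by rewrite ler_piMl// exprn_ile1// ltW.
have sumS : \sum_(0 <= n < N.+1) 'C(2 * n, n + m)%:R * (t / (1 + t) ^+ 2) ^+ n =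
    (m == 0)%:R + t / (1 + t) ^+ 2 *
    \sum_(0 <= n < N) 'C(2 * n.+1, n.+1 + m)%:R * (t / (1 + t) ^+ 2) ^+ n.
  rewrite big_nat_recl// big_distrr/= expr0 mulr1; congr (_ + _).
    by case: m {IH}.
  by apply: eq_bigr => n _; rewrite exprS mulrCA.
rewrite {}sumS [X in _ <= _ <= X](_ : _ = t / (1 + t) ^+ 2 *
  (4 * ((4 * (t / (1 + t) ^+ 2)) ^+ N * ((1 + t) / (1 - t))))); last first.
  by rewrite exprS; ring.
set B := _ ^+ N * _ in IH *.
(* The limit and the partial sum obey the same recursion, so the remainder obeys it too, the
   constant 1 for m = 0 cancelling. The weights, 2 + 2 for m = 0 and 1 + 2 + 1 otherwise, add up to
   the factor 4 of the bound. *)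
case: m => [|m].
- have := IH 0%N; have := IH 1%N.
  have -> : \sum_(0 <= n < N) 'C(2 * n.+1, n.+1 + 0)%:R * (t / (1 + t) ^+ 2) ^+ n =
     2 * \sum_(0 <= n < N) 'C(2 * n, n + 0)%:R * (t / (1 + t) ^+ 2) ^+ n +
     2 * \sum_(0 <= n < N) 'C(2 * n, n + 1)%:R * (t / (1 + t) ^+ 2) ^+ n.
    rewrite 2!big_distrr -big_split/=; apply: eq_bigr => n _.
    by rewrite !addn0 addn1 bin_halfS0 natrD !natrM; ring.
  move: (\sum_(0 <= n < N) _) (\sum_(0 <= n < N) _) => S0 S1.
  rewrite eqxx expr1 expr0 mul1r => h1 h0.
  set l := (X in 0 <= X <= _).
  have -> : l = t / (1 + t) ^+ 2 * (2 * ((1 + t) / (1 - t) - S0) +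
     2 * (t * ((1 + t) / (1 - t)) - S1)) by rewrite /l mulr1n; field; rewrite t1n t1n'.
  by rewrite mulr_ge0//= ?ler_wpM2l//; lra.
- have := IH m; have := IH m.+1; have := IH m.+2.
  have -> : \sum_(0 <= n < N) 'C(2 * n.+1, n.+1 + m.+1)%:R * (t / (1 + t) ^+ 2) ^+ n =
     \sum_(0 <= n < N) 'C(2 * n, n + m)%:R * (t / (1 + t) ^+ 2) ^+ n +
     2 * \sum_(0 <= n < N) 'C(2 * n, n + m.+1)%:R * (t / (1 + t) ^+ 2) ^+ n +
     \sum_(0 <= n < N) 'C(2 * n, n + m.+2)%:R * (t / (1 + t) ^+ 2) ^+ n.
    rewrite big_distrr -!big_split/=; apply: eq_bigr => n _.
    by rewrite bin_halfS 2!natrD natrM; ring.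
  move: (\sum_(0 <= n < N) _) (\sum_(0 <= n < N) _) (\sum_(0 <= n < N) _) => S0 S1 S2.
  rewrite eqE/= [t ^+ m.+2]exprS [t ^+ m.+1]exprS; move: (t ^+ m) => p h2 h1 h0.
  set l := (X in 0 <= X <= _).
  have -> : l = t / (1 + t) ^+ 2 * ((p * ((1 + t) / (1 - t)) - S0) +
     2 * (t * p * ((1 + t) / (1 - t)) - S1) +
     (t * (t * p) * ((1 + t) / (1 - t)) - S2)) by rewrite /l mulr0n; field; rewrite t1n t1n'.
  by rewrite mulr_ge0//= ?ler_wpM2l//; lra.
Qed.

(** After exchange of the finite sums, the distance to a multiple of the [N]-th partial sum of the
    polylogarithm consists of fewer than [N] remainders from [bin_half_tail]. It is thus O(N x^N)
    with x = 4t/(1 + t)^2 < 1. *)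
Lemma zeta_star2_gf t j : 0 <= t < 1 ->
  \sum_(1 <= n < N) 'C(2 * n, n)%:R * zeta_star2 R n j * (t / (1 + t) ^+ 2) ^+ n
    @[N --> \oo] --> - 2 * ((1 + t) / (1 - t)) * polylog (2 * j) (- t).
Proof.
move=> /andP[t0 t1]; set y := t / _; set e := (1 + t) / (1 - t).
have e0 : 0 <= e by apply: divr_ge0; lra.
have x0 : 0 <= 4 * y by rewrite mulr_ge0// divr_ge0 ?exprn_ge0 ?addr_ge0.
have x1 : 4 * y < 1.
  by rewrite mulrA ltr_pdivrMr ?exprn_gt0 ?ltr_wpDr//; nra.
have cp : (- 2 * e) * \sum_(1 <= m < N) (- t) ^+ m / m%:R ^+ (2 * j) @[N --> \oo]
    --> - 2 * e * polylog (2 * j) (- t).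
  by apply: cvgMl_tmp; apply: is_cvg_polylog; rewrite normrN ger0_norm.
have := cvg_natmul_expr (4 * y); rewrite x0 x1 => /(_ isT).
move=> /(@cvgMl_tmp _ _ _ _ _ (2 * e)); rewrite mulr0 => c0.
apply: cvg_sub0 cp; apply/norm_cvg0P.
apply: (squeeze_cvgr _ (cvg_cst 0) c0); apply: nearW => N.
rewrite normr_ge0 !fctE /=.
have -> : \sum_(1 <= n < N) 'C(2 * n, n)%:R * zeta_star2 R n j * y ^+ n =
    - 2 * \sum_(1 <= m < N) (-1) ^+ m / m%:R ^+ (2 * j) *
       \sum_(0 <= n < N) 'C(2 * n, n + m)%:R * y ^+ n.
  under eq_big_nat => n /andP[n0 nN] do
    rewrite (@bin_half_zeta_star2 R n j N) ?ltn_addr// mulr_sumr mulr_suml.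
  rewrite exchange_big_nat/= mulr_sumr; apply: eq_big_nat => m /andP[m0 mN].
  (* The extra term n = 0 on the right is 'C(0, m) = 0, as m > 0. *)
  rewrite mulrA [RHS]mulr_sumr [RHS]big_ltn ?(leq_ltn_trans _ mN)//.
  rewrite (@bin_small (2 * 0) (0 + m))//.
  by rewrite mul0r mulr0 add0r; apply: eq_bigr => n _; ring.
rewrite -[- 2 * e * _]mulrA -mulrBr normrM normrN normr_nat -[2 * e * _]mulrA ler_wpM2l//.
rewrite mulr_sumr -sumrB (le_trans (ler_norm_sum _ _ _))//.
apply: (@le_trans _ _ (\sum_(1 <= m < N) (4 * y) ^+ N * e)); last first.
  rewrite sumr_const_nat -[leLHS]mulr_natl [leRHS]mulrCA [e * _]mulrC ler_wpM2r//.
    by rewrite mulr_ge0// exprn_ge0.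
  by rewrite ler_nat leq_subr.
apply: ler_sum_nat => m /andP[m0 mN].
have := @bin_half_tail t N m; rewrite t0 t1 => /(_ isT).
rewrite -/y -/e => /andP[h0 h1]; set S := \sum_(0 <= n < N) _ in h0 h1 *.
rewrite [X in `|X|](_ : _ = - ((-1) ^+ m / m%:R ^+ (2 * j) * (t ^+ m * e - S))); last first.
  by rewrite [(- t) ^+ m]exprNn; ring.
rewrite normrN normrM (ger0_norm h0) (le_trans _ h1)// ler_piMl//.
rewrite normrM normrX normrN1 expr1n mul1r normfV ger0_norm ?exprn_ge0//.
by rewrite invf_le1 ?exprn_gt0 ?ltr0n// -natrX ler1n expn_gt0 m0.
Qed.

End GeneratingFunction.

(** * Logarithmic moments *)

Section LogIntegral.
Variable R : realType.
Implicit Types (t a u : R) (n k : nat).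

(** The variable u = - ln x / 2, in which the moments are computed. *)
Definition halflog t : R := ln ((1 + t) / (2 * Num.sqrt t)).

Lemma halflog_arg_gt0 t : 0 < t -> 0 < (1 + t) / (2 * Num.sqrt t).
Proof. by move=> t0; rewrite divr_gt0 ?addr_gt0 ?mulr_gt0 ?sqrtr_gt0. Qed.

Lemma halflog_ge0 t : 0 < t -> 0 <= halflog t.
Proof.
move=> t0; apply: ln_ge0; rewrite ler_pdivlMr ?mulr_gt0 ?sqrtr_gt0// mul1r.
(* AM-GM for 1 and [t]. *)
have := sqr_ge0 (1 - Num.sqrt t); have := sqr_sqrtr (ltW t0); nra.
Qed.

Lemma halflog1 : halflog 1 = 0.
Proof. by rewrite /halflog sqrtr1 mulr1 divff ?ln1// pnatr_eq0. Qed.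

Lemma expR_halflog t n : 0 < t ->
  expR (- (2 * n%:R * halflog t)) = (4 * (t / (1 + t) ^+ 2)) ^+ n.
Proof.
move=> t0; rewrite -mulrA mulrCA expRN expRM_natl -exprVn; congr (_ ^+ _).
rewrite expRM_natl lnK ?posrE ?halflog_arg_gt0// exprMn exprVn exprMn.
rewrite sqr_sqrtr ?ltW// invfM invrK; field.
by rewrite !lt0r_neq0// addr_gt0.
Qed.

Lemma is_derive_halflog t : 0 < t ->
  is_derive t 1 halflog (- ((1 - t) / (2 * (t * (1 + t))))).
Proof.
move=> t0; have q0 := halflog_arg_gt0 t t0.
have s0 : 0 < Num.sqrt t by rewrite sqrtr_gt0.
pose g x : R := ln (1 + x) - (ln 2 + ln (Num.sqrt x)).
have gE : {near t, g =1 halflog}.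
  near=> x; have x0 : 0 < x by near: x; exact: lt_nbhsr.
  by rewrite /halflog ln_div ?posrE ?mulr_gt0 ?sqrtr_gt0 ?addr_gt0// lnM ?posrE ?sqrtr_gt0.
apply: (near_eq_is_derive gE).
have d1 : is_derive t 1 (fun x : R => ln (1 + x)) ((1 + t)^-1 * 1).
  apply: (@is_derive1_comp R (@ln R) (fun x => 1 + x) t (1 + t)^-1 1).
    by apply: is_derive1_ln; rewrite addr_gt0.
  rewrite (_ : +%R 1 = cst 1 + id :> (R -> R)); last by [].
  by apply: is_derive_eq; rewrite add0r mulr1.
have d2 : is_derive t 1 (fun x : R => ln (Num.sqrt x)) ((Num.sqrt t)^-1 * (2 * Num.sqrt t)^-1).
  apply: (@is_derive1_comp R (@ln R) (@Num.sqrt R) t).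
    exact: is_derive1_ln.
  exact: is_derive1_sqrt.
rewrite (_ : g = (fun x => ln (1 + x)) - (cst (ln 2) + (fun x => ln (Num.sqrt x)))); last by [].
apply: (@is_derive_eq _ _ _ _ _ _ _
  ((1 + t)^-1 * 1 - (0 + (Num.sqrt t)^-1 * (2 * Num.sqrt t)^-1))).
  exact: (is_deriveB d1 (is_deriveD (is_derive_cst (ln 2 : R^o) t 1) d2)).
rewrite mulr1 add0r invfM mulrCA -invfM -expr2 sqr_sqrtr ?ltW//; field.
by rewrite !lt0r_neq0// addr_gt0.
Unshelve. all: by end_near. Qed.

(* At [u = halflog t] this is a primitive of
   [x ^ n * halflog t ^ k * x' / x] with [x = 4 t / (1 + t) ^ 2 = exp (- 2 u)]. *)
Fixpoint moment_prim n k u : R :=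
  if k is k'.+1 then
    (u ^+ k * expR (- (2 * n%:R * u))) / n%:R + k%:R / (2 * n%:R) * moment_prim n k' u
  else expR (- (2 * n%:R * u)) / n%:R.

(** Integration by parts: the recursive call cancels the term that comes from differentiating the
    power of [u]. *)
Lemma is_derive_moment_prim n k u : (0 < n)%N ->
  is_derive u 1 (moment_prim n k) (- (2 * (u ^+ k * expR (- (2 * n%:R * u))))).
Proof.
move=> n0; have nR : n%:R != 0 :> R by rewrite pnatr_eq0 -lt0n.
have de : is_derive u 1 (fun x => expR (- (2 * n%:R * x)))
    (- (2 * n%:R) * expR (- (2 * n%:R * u))).
  have dl : is_derive u 1 (fun x : R => - (2 * n%:R * x)) (- (2 * n%:R)).
    have := is_deriveN (is_deriveZ (2 * n%:R) (is_derive_id u (1 : R))).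
    by rewrite scaler1.
  rewrite [- _ * _]mulrC; exact: (@is_derive1_comp R expR _ u _ _ (is_derive_expR _) dl).
elim: k => [|k IH].
  apply: (@is_derive_eq _ _ _ _ _ _ _ (n%:R^-1 *: (- (2 * n%:R) * expR (- (2 * n%:R * u))))).
    rewrite [moment_prim _ _](_ : _ = n%:R^-1 \*: (fun x => expR (- (2 * n%:R * x)))).
      exact: is_deriveZ.
    by apply/funext => x; rewrite /= mulrC.
  by rewrite expr0 mul1r /GRing.scale/=; field.
rewrite [moment_prim _ _](_ : _ = n%:R^-1 \*: ((id ^+ k.+1) * (fun x => expR (- (2 * n%:R * x))))
   + (k.+1%:R / (2 * n%:R)) \*: moment_prim n k); last first.
  by apply/funext => x; rewrite /= !fctE [LHS]/= mulrC.
apply: is_derive_eq; rewrite /GRing.scale/= mulr1 !fctE/= exprS; field.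
by rewrite nR.
Qed.

Lemma moment_prim0 n k : (0 < n)%N ->
  moment_prim n k 0 = k`!%:R / (2 ^+ k * n%:R ^+ k.+1).
Proof.
move=> n0; have nR : n%:R != 0 :> R by rewrite pnatr_eq0 -lt0n.
elim: k => [|k IH] /=.
  by rewrite mulr0 oppr0 expR0 fact0 expr0 expr1 !mul1r.
rewrite IH expr0n mul0r mul0r add0r factS natrM !exprS; field.
by rewrite nR !expf_neq0.
Qed.

(** Since exp u >= u^(k+1) / (k+1)!, the product is at most (k+1)! / u. *)
Lemma cvg_powN_expR k : u ^+ k * expR (- u) @[u --> +oo] --> (0 : R).
Proof.
have h u : 0 < u -> 0 <= u ^+ k * expR (- u) <= k.+1`!%:R * u^-1.
  move=> u0; have u0' := ltW u0; rewrite mulr_ge0 ?exprn_ge0 ?expR_ge0//=.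
  rewrite expRN ler_pdivrMr ?expR_gt0// mulrAC ler_pdivlMr// -exprSr mulrC.
  rewrite -ler_pdivrMr ?ltr0n ?fact_gt0// (le_trans _ (expR_ge1Dxn k u0'))//.
  by rewrite lerDr.
apply: (@squeeze_cvgr _ _ _ _ (cst 0) (fun u => k.+1`!%:R * u^-1)).
- near=> u; apply: h; near: u; exact: nbhs_pinfty_gt.
- exact: cvg_cst.
- rewrite -[X in _ --> X](mulr0 (k.+1`!%:R : R)); apply: cvgMl_tmp.
  apply/gtr0_cvgV0 => //.
  near=> u; near: u; exact: nbhs_pinfty_gt.
Unshelve. all: by end_near. Qed.

Lemma cvg_moment_prim n k : (0 < n)%N -> moment_prim n k u @[u --> +oo] --> (0 : R).
Proof.
move=> n0.
have h i : u ^+ i * expR (- (2 * n%:R * u)) / n%:R @[u --> +oo] --> (0 : R).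
  rewrite -[X in _ --> X](mul0r (n%:R^-1 : R)); apply: cvgMr_tmp.
  apply: (squeeze_cvgr _ (cvg_cst 0) (cvg_powN_expR i)).
  near=> u; have u0 : 0 <= u by near: u; exact: nbhs_pinfty_ge.
  rewrite mulr_ge0 ?exprn_ge0 ?expR_ge0//= ler_wpM2l ?exprn_ge0// ler_expR.
  rewrite lerN2 ler_peMl// -natrM ler1n; lia.
elim: k => [|k IH] /=.
  by have := h 0; under eq_cvg do rewrite expr0 mul1r.
rewrite -[X in _ --> X]addr0; apply: cvgD; first exact: h.
rewrite -[X in _ --> X](mulr0 (k.+1%:R / (2 * n%:R) : R)).
exact: cvgMl_tmp.
Unshelve. all: by end_near. Qed.

Lemma halflog_cvg : halflog t @[t --> 0^'+] --> +oo.
Proof.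
apply/cvgryPge => A.
near=> t.
have t0 : 0 < t by near: t; exact: nbhs_right_gt.
(* The threshold makes exp(- 2 [halflog t]) = 4t/(1 + t)^2 <= 4t <= exp(- 2A). *)
have : t <= expR (- (2 * A)) / 4.
  by near: t; apply: nbhs_right_le; rewrite divr_gt0 ?expR_gt0.
rewrite -(ler_expR A) => h.
suff : expR (- (2 * 1%:R * halflog t)) <= expR (- (2 * A)).
  rewrite ler_expR; rewrite ler_expR; lra.
rewrite expR_halflog// expr1.
rewrite (@le_trans _ _ (4 * t))//; last by rewrite mulrC -ler_pdivlMr.
rewrite ler_wpM2l// ler_pdivrMr ?exprn_gt0 ?addr_gt0//.
by rewrite ler_peMr ?exprn_ege1 ?lerDl// ltW.
Unshelve. all: by end_near. Qed.

(** The last factor is x'/x, the logarithmic derivative of x = 4t/(1 + t)^2. *)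
Definition moment_integrand n k t : R :=
  (4 * (t / (1 + t) ^+ 2)) ^+ n * halflog t ^+ k * ((1 - t) / (t * (1 + t))).

Lemma moment_integrand_ge0 n k t : 0 < t <= 1 -> 0 <= moment_integrand n k t.
Proof.
move=> /andP[t0 t1]; have ? := halflog_ge0 t t0.
rewrite !mulr_ge0 ?exprn_ge0 ?invr_ge0 ?mulr_ge0 ?invr_ge0 ?exprn_ge0 ?subr_ge0 ?addr_ge0//; exact: ltW.
Qed.

Lemma is_derive_moment n k t : (0 < n)%N -> 0 < t ->
  is_derive t 1 (moment_prim n k \o halflog) (moment_integrand n k t).
Proof.
move=> n0 t0.
have := @is_derive1_comp R _ halflog t _ _
  (is_derive_moment_prim n k (halflog t) n0) (is_derive_halflog t t0).
move/is_derive_eq; apply; rewrite expR_halflog// /moment_integrand.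
move: (_ ^+ n) (_ ^+ k) => p q; field.
by rewrite !lt0r_neq0// addr_gt0.
Qed.

Lemma continuous_moment n k t : 0 < t -> {for t, continuous (moment_integrand n k)}.
Proof.
move=> t0; have t1 : 1 + t != 0 by rewrite lt0r_neq0// addr_gt0.
have c1 : (fun x : R => 1 + x) @ t --> 1 + t by apply: cvgD; [exact: cvg_cst|exact: cvg_id].
apply: cvgM; [apply: cvgM|].
- apply: (@cvg_comp _ _ _ (fun x => 4 * (x / (1 + x) ^+ 2)) (fun x => x ^+ n)); last exact: exprn_continuous.
  apply: cvgMl_tmp; apply: cvgM; first exact: cvg_id.
  apply: cvgV; first by rewrite expf_neq0.
  by apply: (@cvg_comp _ _ _ _ (fun x => x ^+ 2) _ _ _ c1); exact: exprn_continuous.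
- apply: (@cvg_comp _ _ _ halflog (fun x => x ^+ k)); last exact: exprn_continuous.
  apply: differentiable_continuous; apply/derivable1_diffP.
  by have [] := is_derive_halflog t t0.
- apply: cvgM; first by apply: cvgB; [exact: cvg_cst|exact: cvg_id].
  apply: cvgV; first by rewrite mulf_neq0// lt0r_neq0.
  by apply: cvgM; [exact: cvg_id|exact: c1].
Qed.

Lemma integral_moment_itvcc n k a : (0 < n)%N -> 0 < a < 1 ->
  (\int[@lebesgue_measure R]_(t in `[a, 1%R]) (moment_integrand n k t)%:E =
   (moment_prim n k 0 - moment_prim n k (halflog a))%R%:E)%E.
Proof.
move=> n0 /andP[a0 a1].
have d t : a <= t -> derivable (moment_prim n k \o halflog) t 1.
  by move=> at_; have [] := is_derive_moment n k t n0 (lt_le_trans a0 at_).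
have cF t : a <= t -> {for t, continuous (moment_prim n k \o halflog)}.
  by move=> at_; apply: differentiable_continuous; apply/derivable1_diffP; exact: d.
rewrite (@continuous_FTC2 _ _ (moment_prim n k \o halflog))//=.
- by rewrite halflog1 EFinB.
- apply: continuous_in_subspaceT => t; rewrite inE/= in_itv/= => /andP[at_ _].
  by apply: continuous_moment; exact: lt_le_trans at_.
- split.
  + by move=> t; rewrite in_itv/= => /andP[/ltW at_ _]; exact: d.
  + apply: cvg_at_right_filter; exact: cF.
  + by apply: cvg_at_left_filter; apply: cF; exact: ltW.
- move=> t; rewrite in_itv/= => /andP[at_ _].
  rewrite derive1E; have [] := is_derive_moment n k t n0 (lt_trans a0 at_).
  by [].
Qed.

Lemma measurable_moment n k : measurable_fun (`]0, 1[ : set R) (moment_integrand n k).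
Proof.
apply: open_continuous_measurable_fun => //.
by move=> t; rewrite inE/= in_itv/= => /andP[t0 _]; exact: continuous_moment.
Qed.

(** Monotone convergence along the intervals [1/(i + 1), 1]. The boundary term at the left end
    vanishes in the limit, since [halflog] tends to infinity at 0. *)
Lemma integral_moment n k : (0 < n)%N ->
  (\int[@lebesgue_measure R]_(t in `]0%R, 1%R[) (moment_integrand n k t)%:E =
   (k`!%:R / (2 ^+ k * n%:R ^+ k.+1))%R%:E)%E.
Proof.
move=> n0; have mh := measurable_moment n k.
rewrite integral_itv_bndo_bndc; last exact/measurable_EFinP.
have {}mh : measurable_fun (`]0, 1] : set R) (moment_integrand n k).
  exact/measurable_fun_itv_bndo_bndcP.
rewrite (itv_open_bnd_bigcup false 1 0).
pose D i : set R := `[(0 + i.+1%:R^-1 : R), 1]%classic.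
have sub i : D i `<=` `]0, 1].
  by apply: subset_itvr; rewrite bnd_simp add0r invr_gt0.
have mD i : measurable (D i) by exact: measurable_itv.
have cv : (\int[@lebesgue_measure R]_(x in D i) (moment_integrand n k x)%:E @[i --> \oo]
   --> \int[@lebesgue_measure R]_(x in \bigcup_i D i) (moment_integrand n k x)%:E)%E.
  apply: (@ge0_nondecreasing_set_cvg_integral _ (measurableTypeR R) R D
    (EFin \o moment_integrand n k) (@lebesgue_measure R)) => //.
  - apply/nondecreasing_seqP => i; apply/subsetPset; apply: subset_itvr.
    by rewrite bnd_simp lerD2l lef_pV2 ?posrE// ler_nat.
  - by move=> i; apply/measurable_EFinP; exact: measurable_funS mh.
  - by move=> i x /sub; rewrite /= in_itv/= lee_fin; exact: moment_integrand_ge0.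
apply: (cvg_unique _ cv) => //.
rewrite -moment_prim0//.
have hr : (0 + i.+2%:R^-1 : R) @[i --> \oo] --> (0 : R)^'+.
  have h0 : [sequence @harmonic R i.+1]_i @ \oo --> (0 : R).
    by rewrite cvg_shiftS; exact: cvg_harmonic.
  move=> P /h0; apply: (@filterS nat \oo _) => i /=; rewrite add0r; apply.
  by rewrite invr_gt0.
(* The shift drops the degenerate interval [1, 1], as [integral_moment_itvcc] asks for a < 1. *)
rewrite -[X in X%:E]subr0 /= -cvg_shiftS/=.
under eq_cvg => i.
  rewrite integral_moment_itvcc//; last by rewrite add0r invr_gt0 ltr0n/= invf_lt1 ?ltr1n ?ltr0n.
  over.
apply: cvg_EFin; first exact: nearW.
apply: cvgB; first exact: cvg_cst.
apply: cvg_comp (cvg_moment_prim n k n0).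
exact: cvg_comp halflog_cvg.
Qed.

End LogIntegral.

(** * Exchanging sum and integral *)

Section Assembly.
Variables (R : realType) (j K : nat).
Local Notation mu := (@lebesgue_measure R).

(** The coefficient of x^n in the generating function. In this section [K] stands for k - 1. *)
Let coef n : R := 'C(2 * n, n)%:R / 4 ^+ n * zeta_star2 R n j.

Let coef_ge0 n : 0 <= coef n.
Proof. by rewrite mulr_ge0 ?divr_ge0 ?exprn_ge0 ?zeta_star2_ge0. Qed.

Let integrand (t : R) : R := halflog R t ^+ K * polylog (2 * j) (- t) / t.

(** Bounded monotone partial sums: the star sum is at most 2^j, n^(K+1) is at least n, and
    [sum_bin_half_le] bounds the rest. *)
Lemma is_cvg_coef_series :
  cvgn (fun N => \sum_(0 <= n < N) coef n.+1 * (K`!%:R / (2 ^+ K * n.+1%:R ^+ K.+1))).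
Proof.
apply: nondecreasing_is_cvgn.
  apply/nondecreasing_seqP => N; rewrite big_nat_recr//= lerDl.
  by rewrite mulr_ge0 ?coef_ge0 ?divr_ge0 ?mulr_ge0 ?exprn_ge0.
exists (K`!%:R / 2 ^+ K * 2 ^+ j * 2) => _ [N _ <-].
apply: (@le_trans _ _ (K`!%:R / 2 ^+ K * 2 ^+ j *
   \sum_(1 <= n < N.+1) 'C(2 * n, n)%:R / (n%:R * 4 ^+ n))); last first.
  by rewrite ler_wpM2l ?sum_bin_half_le// mulr_ge0 ?divr_ge0 ?exprn_ge0.
rewrite big_add1/= mulr_sumr; apply: ler_sum => n _.
have n0 : 0 < n.+1%:R :> R by rewrite ltr0n.
rewrite [leLHS](_ : _ = K`!%:R / 2 ^+ K * zeta_star2 R n.+1 j *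
  ('C(2 * n.+1, n.+1)%:R / (n.+1%:R ^+ K.+1 * 4 ^+ n.+1))); last first.
  rewrite /coef !invfM; ring.
apply: ler_pM.
- by rewrite mulr_ge0 ?divr_ge0 ?exprn_ge0 ?zeta_star2_ge0.
- by rewrite divr_ge0 ?mulr_ge0 ?exprn_ge0.
- by rewrite ler_wpM2l ?zeta_star2_le// divr_ge0 ?exprn_ge0.
rewrite ler_wpM2l// lef_pV2 ?posrE ?mulr_gt0 ?exprn_gt0//.
by rewrite ler_wpM2r ?exprn_ge0// ler_eXnr// ler1n.
Qed.

(** The factor (1 + t)/(1 - t) of the generating function cancels against x'/x and leaves 1/t. *)
Lemma cvg_sum_moment_integrand t : 0 < t < 1 ->
  \sum_(0 <= n < N) coef n.+1 * moment_integrand R n.+1 K t @[N --> \oo]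
    --> - 2 * integrand t.
Proof.
move=> /andP[t0 t1]; have t01 : 0 <= t < 1 by rewrite ltW.
have := zeta_star2_gf R t j t01; rewrite -cvg_shiftS/=.
move=> /(@cvgMl_tmp _ _ _ _ _ (halflog R t ^+ K * ((1 - t) / (t * (1 + t))))).
have -> : - 2 * integrand t = halflog R t ^+ K * ((1 - t) / (t * (1 + t))) *
  (- 2 * ((1 + t) / (1 - t)) * polylog (2 * j) (- t)).
  rewrite /integrand; field.
  by rewrite subr_eq0 gt_eqF// !lt0r_neq0// addr_gt0.
apply: cvg_trans; apply: near_eq_cvg; apply: nearW => N /=.
rewrite big_add1/= mulr_sumr; apply: eq_bigr => n _.
rewrite /coef /moment_integrand [(4 * _) ^+ _]exprMn.
have : 4 ^+ n.+1 != 0 :> R by rewrite expf_neq0// pnatr_eq0.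
move: (4 ^+ n.+1) => z z0; move: (_ ^+ n.+1) => y.
field.
by rewrite z0 !lt0r_neq0// addr_gt0.
Qed.

(** Termwise integration of nonnegative functions; the factor -2 makes the total nonnegative.
    Measurability comes along because the polylogarithm is expressed through a series of measurable
    functions. *)
Lemma integral_integrand :
  (\int[mu]_(t in `]0%R, 1%R[) (- 2 * integrand t)%R%:E =
   (limn (fun N => \sum_(0 <= n < N) coef n.+1 * (K`!%:R / (2 ^+ K * n.+1%:R ^+ K.+1))))%R%:E)%E
  /\ measurable_fun (`]0, 1[ : set R) integrand.
Proof.
have sumE t : `]0, 1[%classic t ->
    (- 2 * integrand t)%:E = (\sum_(n <oo) (coef n.+1 * moment_integrand R n.+1 K t)%:E)%E.
  rewrite /= in_itv/= => t01; apply/esym/cvg_lim => //.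
  under eq_cvg do rewrite sumEFin.
  apply: cvg_EFin; first exact: nearW.
  exact: cvg_sum_moment_integrand.
have mh n : measurable_fun (`]0, 1[ : set R)
    (fun t => (coef n.+1 * moment_integrand R n.+1 K t)%:E).
  apply/measurable_EFinP; apply: measurable_funM; first exact: measurable_cst.
  exact: measurable_moment.
have h0 n t : `]0, 1[%classic t -> (0 <= (coef n.+1 * moment_integrand R n.+1 K t)%:E)%E.
  rewrite /= in_itv/= => /andP[t0 t1]; rewrite lee_fin mulr_ge0 ?coef_ge0//.
  by apply: moment_integrand_ge0; rewrite t0 ltW.
have mf : measurable_fun (`]0, 1[ : set R) (fun t => (- 2 * integrand t)%:E).
  apply: (@eq_measurable_fun _ _ _ _ _
    (fun t => (\sum_(n <oo) (coef n.+1 * moment_integrand R n.+1 K t)%:E)%E)).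
    by move=> t; rewrite inE => tD; rewrite sumE.
  by apply: ge0_emeasurable_sum => // n t tD _; exact: h0.
split; last first.
  rewrite (_ : integrand = (fun t => - 2^-1 * (- 2 * integrand t))).
    apply: measurable_funM; first exact: measurable_cst.
    exact/measurable_EFinP.
  by apply/funext => t; field.
transitivity (\int[mu]_(t in `]0%R, 1%R[)
    (\sum_(n <oo) (coef n.+1 * moment_integrand R n.+1 K t)%:E))%E.
  by apply: eq_integral => t; rewrite inE => /sumE.
rewrite integral_nneseries//.
transitivity (\sum_(n <oo) (coef n.+1 * (K`!%:R / (2 ^+ K * n.+1%:R ^+ K.+1)))%:E)%E.
  apply: eq_eseriesr => n _.
  under eq_integral do rewrite EFinM.
  rewrite ge0_integralZl//=.
  - by rewrite integral_moment// -EFinM.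
  - by apply/measurable_EFinP; exact: measurable_moment.
  - move=> t; rewrite in_itv/= => /andP[t0 t1]; rewrite lee_fin.
    by apply: moment_integrand_ge0; rewrite t0 ltW.
  - by rewrite lee_fin coef_ge0.
apply/cvg_lim => //; under eq_cvg do rewrite sumEFin.
apply: cvg_EFin; first exact: nearW.
exact: is_cvg_coef_series.
Qed.

(** For a measurable function, a finite integral entails integrability. The endpoints, where
    [integrand] may take default values (division by 0 at t = 0, a divergent [limn] at t = 1 when j
    = 0), form a null set. *)
Lemma integral_integrand_itvcc :
  mu.-integrable `[0, 1] (EFin \o integrand) /\
  \int[mu]_(t in `[0, 1]) integrand t = - 2^-1 *
    limn (fun N => \sum_(0 <= n < N) coef n.+1 * (K`!%:R / (2 ^+ K * n.+1%:R ^+ K.+1))).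
Proof.
have [intE mf] := integral_integrand; set S := limn _ in intE *.
have mD : measurable (`]0, 1[ : set (measurableTypeR R)) by exact: measurable_itv.
have iD : mu.-integrable `]0, 1[ (fun t => (- 2 * integrand t)%:E).
  have m2 : measurable_fun (`]0, 1[ : set R) (fun t => - 2 * integrand t).
    by apply: measurable_funM => //; exact: measurable_cst.
  apply/integrableP; split; first exact/measurable_EFinP.
  by rewrite (integral_fin_num_abs mu mD m2) intE.
have intf : (\int[mu]_(t in `]0%R, 1%R[) (integrand t)%:E = (- 2^-1 * S)%R%:E)%E.
  rewrite EFinM -intE -integralZl//; apply: eq_integral => t _.
  by rewrite -EFinM; congr EFin; field.
have intf' : (\int[mu]_(t in `[0%R, 1%R]) (integrand t)%:E = (- 2^-1 * S)%R%:E)%E.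
  by rewrite integral_itv_bndoo//; exact/measurable_EFinP.
split; last by rewrite /Rintegral intf'.
have mf' := measurable_fun_itv_cc mf.
apply/integrableP; split; first exact/measurable_EFinP.
by rewrite (integral_fin_num_abs mu (measurable_itv `[0, 1]) mf') intf'.
Qed.

End Assembly.

Theorem theorem3p1 (R : realType) (j k : nat) (hk : (0 < k)%N) :
  let f : R -> R := fun t =>
    ln ((1 + t) / (2 * Num.sqrt t)) ^+ k.-1 * polylog (2 * j) (- t) / t in
  (@lebesgue_measure R).-integrable `[0, 1] (EFin \o f) /\
  (\sum_(1 <= n < N) ('C(2 * n, n)%:R / (n%:R ^+ k * 4 ^+ n)
                        * zeta_star2 R n j)) @[N --> \oo] -->
    - (2 ^+ k / (k.-1)`!%:R) * \int[@lebesgue_measure R]_(t in `[0, 1]) f t.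
Proof.
case: k hk => // K _ f.
have [intf intE] := integral_integrand_itvcc R j K.
split; first exact: intf.
set S := limn _ in intE.
(* The prefactor times -1/2 is 2^K / K!, which cancels the K! / 2^K carried by every moment. *)
have -> : - (2 ^+ K.+1 / K.+1.-1`!%:R) * \int[@lebesgue_measure R]_(t in `[0, 1]) f t =
    2 ^+ K / K`!%:R * S.
  rewrite (intE : \int[@lebesgue_measure R]_(t in `[0, 1]) f t = _).
  by rewrite exprS; field; rewrite pnatr_eq0 -lt0n fact_gt0.
rewrite -cvg_shiftS.
move: (is_cvg_coef_series R j K) => /(@cvgMl_tmp _ _ _ _ _ (2 ^+ K / K`!%:R)).
apply: cvg_trans; apply: near_eq_cvg; apply: nearW => N /=.
rewrite big_add1/= mulr_sumr; apply: eq_bigr => n _.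
have n0 : n.+1%:R ^+ K.+1 != 0 :> R by rewrite expf_neq0// pnatr_eq0.
have z0 : 4 ^+ n.+1 != 0 :> R by rewrite expf_neq0// pnatr_eq0.
have x0 : 2 ^+ K != 0 :> R by rewrite expf_neq0// pnatr_eq0.
have f0 : K`!%:R != 0 :> R by rewrite pnatr_eq0 -lt0n fact_gt0.
move: (4 ^+ n.+1) z0 (n.+1%:R ^+ K.+1) n0 (2 ^+ K) x0 => z z0 y y0 x x0.
by field; rewrite x0 y0 z0 f0.
Qed.
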